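(* Let $\epsilon\in(0,\tfrac12)$ and $K>0$. There is a constant $C>0$, independent of $n$ and $\tau$ (but allowed to depend on $K$, $\epsilon$ and the fixed data: the mesh, the finite element space, $\mathcal{M}$, $\mathcal{S}$, $U_0$, $F$, $T$), such that the following holds. For every time step $\tau=T/N\in(0,1)$ ($N$ a positive integer) satisfying $$\max\{\tau\|\bm{\mathcal{A}}\|_2,\ \|I-\tau\bm{\mathcal{A}}\|_2\}<1$$ and every $0\le n\le N$ with $n\le K\tau^{-\frac12+\epsilon}$, $$\left(\lambda_0(X)-\lambda_0(\bar X_* )\right)^2+\sum_{k=1}^{n}\lambda_k(X)^2\le C\,\tau^{4\epsilon}.$$
   Context: Setting. Let $D\subset\mathbb{R}^d$ ($d=1,2,3$) be a bounded open domain, $T>0$, and let $\alpha(x)=(\alpha_{k,j}(x))_{d\times d}$ be symmetric with entries in $W^{1,\infty}(D)$, $c\in L^\infty(D)$. The underlying problem is $u_t-\nabla\cdot(\alpha\nabla u)+cu=f$ in $D\times(0,T]$ with $u=u_0$ at $t=0$ and $u=0$ on $\partial D\times[0,T]$. Let $\mathbb{V}_h\subset H_0^1(D)$ be a fixed conforming finite element space of standard finite elements of arbitrary order on a fixed shape-regular simplicial mesh of $D$, with interior nodes $x_1,\dots,x_M$ and nodal basis $\varphi_1,\dots,\varphi_M$, $\varphi_k(x_j)=\delta_{kj}$. Write $(\cdot,\cdot)_D$ for the $L^2(D)$ inner product and $a(u,v)=(\alpha\nabla u,\nabla v)_D+(cu,v)_D$. Define the $M\times M$ matrices $\mathcal{M}=((\varphi_k,\varphi_j)_D)$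 and $\mathcal{S}=(a(\varphi_k,\varphi_j))$, both symmetric positive definite (standing assumption), and the load vector $F=((f,\varphi_1)_D,\dots,(f,\varphi_M)_D)^\top\in\mathbb{R}^M$, which does not depend on the time index. Let $U_0\in\mathbb{R}^M$ be the vector of values at $x_1,\dots,x_M$ of the interpolant of $u_0$ in $\mathbb{V}_h$. With $\tau=T/N$, the vectors $U_1,\dots,U_N\in\mathbb{R}^M$ are defined (backward Euler) by $$(\mathcal{M}+\tau\mathcal{S})U_m=\mathcal{M}U_{m-1}+\tau F,\qquad m=1,\dots,N.$$ Set $\bm{\mathcal{A}}=\mathcal{M}^{-1/2}\mathcal{S}\mathcal{M}^{-1/2}$; $\|\cdot\|_2$ is the spectral norm and $I$ the $M\times M$ identity matrix. For $0\le n\le N$ let $U=(U_0,U_1,\dots,U_n)$ (an $M\times(n+1)$ matrix) and $X=U^\top U$. Define the reference vectors $\bar U_m^*=(1-\tau\|\bm{\mathcal{A}}\|_2)^m U_0$ for $m=0,\dots,n$, and let $\bar U_*=(\bar U_0^*,\dots,\bar U_n^* )$, $\bar X_*=\bar U_*^\top\bar U_*$. For a symmetric $(n+1)\times(n+1)$ matrix $Y$, $\lambda_0(Y)\ge\lambda_1(Y)\ge\dots\ge\lambda_n(Y)$ denote its eigenvalues. *)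

(* Defs.v *)
From HB Require Import structures.
From mathcomp Require Import all_boot all_order all_algebra.
From mathcomp Require Import all_classical all_reals all_analysis.
From mathcomp.real_closed Require complex.
Set Implicit Arguments.
Unset Strict Implicit.
Unset Printing Implicit Defensive.
Import Order.TTheory GRing.Theory Num.Theory.
Import numFieldNormedType.Exports.
Local Open Scope classical_set_scope.
Local Open Scope ring_scope.

(* d-dimensional Lebesgue measure on [d.-tuple R], the iterated product of    *)
(* the one-dimensional one; [lebesgue_box] is its characteristic property.    *)
Section LebesgueSucc.
Context {R : realType} (n : nat).
Notation RR := (measurableTypeR R).
Variable mu : {sigma_finite_measure set (n.-tuple RR) -> \bar R}.

Definition tcons (p : RR * n.-tuple RR) : n.+1.-tuple RR :=
  [tuple of p.1 :: p.2].

Lemma measurable_tcons : measurable_fun [set: RR * n.-tuple RR] tcons.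
Proof. by apply: measurable_cons. Qed.

Definition leb_succ : set (n.+1.-tuple RR) -> \bar R :=
  pushforward (product_measure1 lebesgue_measure mu) tcons.

Let leb_succ0 : leb_succ set0 = 0%E.
Proof. by rewrite /leb_succ /pushforward preimage_set0 measure0. Qed.

Let leb_succ_ge0 A : (0 <= leb_succ A)%E.
Proof. exact: (@measure_ge0 _ _ _ (product_measure1 lebesgue_measure mu)). Qed.

Let leb_succ_sigma_additive : semi_sigma_additive leb_succ.
Proof.
move=> F mF tF mUF; rewrite /leb_succ /pushforward preimage_bigcup.
apply: (@measure_semi_sigma_additive _ _ _
  (product_measure1 lebesgue_measure mu)).
- by move=> k; rewrite -[X in measurable X]setTI; exact: measurable_tcons.
- apply/trivIsetP => /= i j _ _ ij; rewrite -preimage_setI.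
  by move/trivIsetP : tF => /(_ _ _ _ _ ij) ->//; rewrite preimage_set0.
- rewrite -preimage_bigcup -[X in measurable X]setTI.
  exact: measurable_tcons.
Qed.

HB.instance Definition _ := isMeasure.Build _ _ _ leb_succ
  leb_succ0 leb_succ_ge0 leb_succ_sigma_additive.

Let leb_succ_sigma_finite : sigma_finite setT leb_succ.
Proof.
have /sigma_finiteP[F [FT ndF Foo]] := sigma_finiteT (@lebesgue_measure R).
have /sigma_finiteP[G [GT ndG Goo]] := sigma_finiteT mu.
have mh : measurable_fun [set: n.+1.-tuple RR] (@thead n RR).
  rewrite (_ : @thead n RR = (@tnth _ RR ^~ ord0)); last by apply/funext.
  exact: measurable_tnth.
have mb := @measurable_behead _ RR n.
exists (fun k => @thead n RR @^-1` F k `&`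
   (fun t : n.+1.-tuple RR => [tuple of behead t]) @^-1` G k).
  apply/esym/seteqP; split=> // t _.
  have [k _ Fk] : (\bigcup_k F k) (thead t) by rewrite -FT.
  have [l _ Gl] : (\bigcup_k G k) [tuple of behead t] by rewrite -GT.
  exists (maxn k l) => //; split => /=.
  - by move: Fk; exact/subsetPset/ndF/leq_maxl.
  - by move: Gl; exact/subsetPset/ndG/leq_maxr.
move=> k; have [mF oF] := Foo k; have [mG oG] := Goo k; split.
  apply: measurableI; rewrite -[X in measurable X]setTI.
    exact: mh.
  exact: mb.
rewrite /leb_succ /pushforward.
rewrite (_ : _ @^-1` _ = F k `*` G k).
  by rewrite product_measure1E// lte_mul_pinfty// ge0_fin_numE.
apply/seteqP; split=> -[x t] /=; rewrite theadE.
  by move=> [Fx Gt]; split => //=; move: Gt; congr (G k); exact: val_inj.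
by move=> [Fx Gt]; split => //=; move: Gt; congr (G k); exact: val_inj.
Qed.

HB.instance Definition _ := Measure_isSigmaFinite.Build _ _ _ leb_succ
  leb_succ_sigma_finite.

End LebesgueSucc.

Fixpoint lebesgue (R : realType) (d : nat) :
    {sigma_finite_measure set (d.-tuple (measurableTypeR R)) -> \bar R} :=
  match d with
  | 0 => \d_([tuple] : 0.-tuple (measurableTypeR R))
  | d'.+1 => leb_succ (lebesgue R d')
  end.

Lemma lebesgue_box (R : realType) (d : nat)
    (A : 'I_d -> set (measurableTypeR R)) :
  (forall i, measurable (A i)) ->
  lebesgue R d [set t | forall i, A i (tnth t i)] =
    (\prod_(i < d) lebesgue_measure (A i))%E.
Proof.
elim: d A => [|d IH] A mA /=.
  rewrite big_ord0 diracE mem_set//; first by move=> [].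
have mB : measurable [set t : d.-tuple (measurableTypeR R) |
    forall i, A (lift ord0 i) (tnth t i)].
  rewrite (_ : [set _ | _] = \big[setI/setT]_(i < d)
      ((fun t : d.-tuple (measurableTypeR R) => tnth t i) @^-1` A (lift ord0 i))).
    apply: bigsetI_measurable => i _; rewrite -[X in measurable X]setTI.
    exact: measurable_tnth.
  rewrite -bigcap_seq; apply/seteqP; split => t /= h i.
    by move=> _; exact: h.
  by apply: h; rewrite /= mem_index_enum.
rewrite /leb_succ /pushforward (_ : _ @^-1` _ = A ord0 `*`
   [set t : d.-tuple (measurableTypeR R) |
    forall i, A (lift ord0 i) (tnth t i)]).
  rewrite product_measure1E//= big_ord_recl; congr (_ * _)%E.
  exact: (IH (fun i => A (lift ord0 i))).
apply/seteqP; split=> -[x t] /=.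
  move=> h; split=> [|i]; first exact: (h ord0).
  by have := h (lift ord0 i); rewrite tnthS.
move=> [Ax At] i; case: (unliftP ord0 i) => [j ->|->//].
by rewrite tnthS; exact: At.
Qed.

Section FunctionSpaces.
Context {R : realType} {d : nat}.
Local Notation point := 'rV[R]_d.
Local Notation mu := (lebesgue R d).
Implicit Types (D : set point) (f g v : point -> R).

Definition of_coords (t : d.-tuple (measurableTypeR R)) : point :=
  \row_i tnth t i.

Definition coords D : set (d.-tuple (measurableTypeR R)) := of_coords @^-1` D.

Definition measurable_on D f := measurable_fun (coords D) (f \o of_coords).

Definition integrable_on D f :=
  mu.-integrable (coords D) (EFin \o (f \o of_coords)).

Definition integral_on D f : R := \int[mu]_(t in coords D) f (of_coords t).

Definition inner_L2 D f g : R := integral_on D (fun y => f y * g y).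

Definition in_L2 D f :=
  measurable_on D f /\ integrable_on D (fun y => f y ^+ 2).

Definition in_Linfty D f := measurable_on D f /\
  exists B : R, {ae mu, forall t, coords D t -> `|f (of_coords t)| <= B}.

Definition locally_integrable_on D f := measurable_on D f /\
  forall K : set point, compact K -> K `<=` D -> integrable_on K f.

Definition partial (i : 'I_d) f : point -> R := fun y => 'D_'e_i f y.

Definition smooth f := forall (s : seq 'I_d) (y : point),
  differentiable (foldr partial f s) y.

(* C_c^infty(D) *)
Definition test_function D f := smooth f /\
  exists K : set point, [/\ compact K, K `<=` D & forall y, ~ K y -> f y = 0].

Definition weak_partial D (i : 'I_d) v g :=
  [/\ locally_integrable_on D v, locally_integrable_on D g &
      forall p, test_function D p ->
        integral_on D (fun y => v y * partial i p y) =
        - integral_on D (fun y => g y * p y)].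

(* A version of the i-th weak partial derivative of v on D (unique a.e.).     *)
Definition wpartial D (i : 'I_d) v : point -> R :=
  xget (fun=> 0) [set g | weak_partial D i v g].

Definition in_W1infty D v := in_Linfty D v /\
  forall i, exists2 g, weak_partial D i v g & in_Linfty D g.

Definition in_H1 D v := in_L2 D v /\
  forall i, exists2 g, weak_partial D i v g & in_L2 D g.

Definition cvg_L2 D (p : nat -> point -> R) v :=
  (fun n => (\int[mu]_(t in coords D)
     ((p n (of_coords t) - v (of_coords t)) ^+ 2)%:E)%E) @ \oo --> 0%E.

(* H^1_0(D) is the closure of C_c^infty(D) in H^1(D). *)
Definition in_H10 D v := in_H1 D v /\
  exists p : nat -> point -> R, [/\ forall n, test_function D (p n),
    cvg_L2 D p v &
    forall i, cvg_L2 D (fun n => partial i (p n)) (wpartial D i v)].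

Definition bounded_domain D :=
  [/\ D !=set0, open D, connected D & bounded_set D].

(* a(u,v) = (alpha grad u, grad v)_D + (c u, v)_D *)
Definition bilinear_form D (alpha : point -> 'M[R]_d) (c : point -> R)
    (u v : point -> R) : R :=
  (\sum_(k < d) \sum_(j < d)
    inner_L2 D (fun y => alpha y k j * wpartial D j u y) (wpartial D k v))
  + inner_L2 D (fun y => c y * u y) v.

End FunctionSpaces.

Section FiniteElements.
Context {R : realType} {d : nat}.
Local Notation point := 'rV[R]_d.
Implicit Types (D : set point).

(* A simplex is given by its d+1 vertices. *)
Definition simplex (v : 'I_d.+1 -> point) : set point :=
  [set y | exists l : 'I_d.+1 -> R,
     [/\ forall i, 0 <= l i, \sum_i l i = 1 & y = \sum_i l i *: v i]].

Definition nondegenerate (v : 'I_d.+1 -> point) :=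
  \det (\matrix_(i < d, j < d) (v (lift ord0 i) - v ord0) ord0 j) != 0.

(* Convex hull of the vertices that v and w share. *)
Definition common_face (v w : 'I_d.+1 -> point) : set point :=
  [set y | exists l : 'I_d.+1 -> R,
     [/\ forall i, 0 <= l i, \sum_i l i = 1, y = \sum_i l i *: v i &
         forall i, l i != 0 -> exists j, v i = w j]].

(* [mesh s i] is the i-th vertex of the s-th simplex. *)
Definition simplicial_mesh D (J : nat) (mesh : 'I_J -> 'I_d.+1 -> point) :=
  [/\ forall s, nondegenerate (mesh s),
      forall s t, s != t -> exists i, forall j, mesh s i <> mesh t j,
      forall s t, simplex (mesh s) `&` simplex (mesh t) =
                  common_face (mesh s) (mesh t) &
      closure D = \bigcup_s simplex (mesh s)].

(* Polynomial functions of total degree at most r. *)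
Definition polynomial_fun (r : nat) (p : point -> R) :=
  exists c : {ffun 'I_d -> 'I_r.+1} -> R, forall y,
    p y = \sum_(a : {ffun 'I_d -> 'I_r.+1} | (\sum_i a i <= r)%N)
            c a * \prod_i y ord0 i ^+ a i.

(* V_h : continuous piecewise polynomials of degree r in H^1_0(D). *)
Definition fe_space D (J : nat) (mesh : 'I_J -> 'I_d.+1 -> point) (r : nat)
    (v : point -> R) :=
  [/\ in_H10 D v, {within closure D, continuous v} &
      forall s, exists2 p, polynomial_fun r p &
        forall y, simplex (mesh s) y -> v y = p y].

(* Principal lattice of order r of each simplex. *)
Definition lagrange_node (J : nat) (mesh : 'I_J -> 'I_d.+1 -> point) (r : nat)
    (y : point) :=
  exists (s : 'I_J) (a : 'I_d.+1 -> nat), (\sum_i a i)%N = r /\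
    y = \sum_i ((a i)%:R / r%:R : R) *: mesh s i.

Definition interior_nodes D (J : nat) (mesh : 'I_J -> 'I_d.+1 -> point)
    (r : nat) (M : nat) (x : 'I_M -> point) :=
  injective x /\
  forall y, (exists k, x k = y) <-> (lagrange_node mesh r y /\ D y).

Definition nodal_basis D (J : nat) (mesh : 'I_J -> 'I_d.+1 -> point) (r : nat)
    (M : nat) (x : 'I_M -> point) (phi : 'I_M -> point -> R) :=
  [/\ forall k, fe_space D mesh r (phi k),
      forall k j, phi k (x j) = (k == j)%:R &
      forall v, fe_space D mesh r v -> forall y, D y ->
        v y = \sum_k v (x k) * phi k y].

Definition interpolant (M : nat) (x : 'I_M -> point) (phi : 'I_M -> point -> R)
    (u : point -> R) : point -> R :=
  fun y => \sum_k u (x k) * phi k y.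

Definition mass_matrix D (M : nat) (phi : 'I_M -> point -> R) : 'M[R]_M :=
  \matrix_(k, j) inner_L2 D (phi k) (phi j).

Definition stiffness_matrix D (alpha : point -> 'M[R]_d) (c : point -> R)
    (M : nat) (phi : 'I_M -> point -> R) : 'M[R]_M :=
  \matrix_(k, j) bilinear_form D alpha c (phi k) (phi j).

Definition load_vector D (f : point -> R) (M : nat)
    (phi : 'I_M -> point -> R) : 'cV[R]_M :=
  \col_k inner_L2 D f (phi k).

Definition nodal_values (M : nat) (x : 'I_M -> point) (u : point -> R) :
    'cV[R]_M := \col_k u (x k).

End FiniteElements.

Section LinearAlgebra.
Context {R : realType}.

Definition posdef (M : nat) (A : 'M[R]_M) :=
  A^T = A /\ forall v : 'cV[R]_M, v != 0 -> 0 < (v^T *m A *m v) ord0 ord0.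

(* The unique positive definite square root of a positive definite A. *)
Definition sqrtmx (M : nat) (A : 'M[R]_M) : 'M[R]_M :=
  xget 0 [set B | posdef B /\ B *m B = A].

Definition enorm (M : nat) (v : 'cV[R]_M) : R :=
  Num.sqrt (\sum_i v i ord0 ^+ 2).

Definition spectral_norm (M : nat) (A : 'M[R]_M) : R :=
  sup [set enorm (A *m v) | v in [set v : 'cV[R]_M | enorm v <= 1]].

(* A^(-1/2) B A^(-1/2) *)
Definition scaled_stiffness (M : nat) (A B : 'M[R]_M) : 'M[R]_M :=
  invmx (sqrtmx A) *m B *m invmx (sqrtmx A).

Definition ordered_spectrum (m : nat) (Y : 'M[R]_m) (s : seq R) :=
  sorted >=%R s /\ char_poly Y = \prod_(a <- s) ('X - a%:P).

(* Some such sequence, unique if it exists; it does for symmetric Y by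
   [symmetric_spectrum]. *)
Definition spectrum_seq (m : nat) (Y : 'M[R]_m) : seq R :=
  xget [::] [set s | ordered_spectrum Y s].

Definition eigval (m : nat) (Y : 'M[R]_m) (k : nat) : R :=
  nth 0 (spectrum_seq Y) k.

End LinearAlgebra.

Section SymmetricSpectrum.
Import complex.
Context {R : realType}.

Lemma symmetric_spectrum (m : nat) (Y : 'M[R]_m) :
  Y^T = Y -> ordered_spectrum Y (spectrum_seq Y).
Proof.
move=> Ysym; apply: (@xgetPex _ [::] [set s | ordered_spectrum Y s]).
pose toC : {rmorphism R -> R[i]%C} :=
  real_complex R.
pose YC := map_mx toC Y.
have YCh : YC \is hermsymmx.
  apply: realsym_hermsym.
    apply/is_hermitianmxP; rewrite expr0 scale1r map_mx_id//.
    by rewrite /YC map_trmx Ysym.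
  by apply/mxOverP => i j; rewrite mxE; apply/complex_realP; exists (Y i j).
have /orthomx_spectralP YE := hermitian_normalmx YCh.
have Dr := hermitian_spectral_diag_real YCh.
set P := spectralmx YC in YE; set D := spectral_diag YC in YE Dr.
have Pu : P \in unitmx by exact: spectral_unit.
have pE : char_poly YC = \prod_(i < m) ('X - (D ord0 i)%:P).
  have -> : char_poly YC = char_poly (diag_mx D).
    have PE : YC = invmx P *m (diag_mx D *m P) by rewrite mulmxA.
    rewrite /char_poly {1}PE /char_poly_mx.
    have -> : 'X%:M - map_mx polyC (invmx P *m (diag_mx D *m P)) =
       map_mx polyC (invmx P) *m (('X%:M - map_mx polyC (diag_mx D)) *m map_mx polyC P).
      rewrite !map_mxM mulmxBl mulmxBr; congr (_ - _).
      by rewrite mul_scalar_mx -scalemxAr -map_mxM mulVmx// map_mx1 scalemx1.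
    rewrite !det_mulmx mulrCA -det_mulmx -map_mxM mulVmx// map_mx1 det1 mulr1//.
  rewrite char_poly_trig ?diag_mx_is_trig//.
  by apply: eq_bigr => i _; rewrite mxE eqxx.
pose s := [seq complex.Re (D ord0 i) | i <- index_enum 'I_m].
exists (sort >=%R s); split.
  by apply: sort_sorted => x y; exact: le_total.
apply: (@map_poly_inj _ _ toC).
rewrite map_char_poly -/YC pE rmorph_prod/= (perm_big s) ?perm_sort//=.
rewrite big_map; apply: eq_bigr => i _.
rewrite rmorphB/= map_polyX map_polyC/= RRe_real//.
by move/mxOverP: Dr; exact.
Qed.

End SymmetricSpectrum.

Section Snapshots.
Context {R : realType}.

Definition snapshots (M n : nat) (U : nat -> 'cV[R]_M) : 'M[R]_(M, n.+1) :=
  \matrix_(i, j) U j i ord0.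

Definition gram (M n : nat) (U : nat -> 'cV[R]_M) : 'M[R]_n.+1 :=
  (snapshots n U)^T *m snapshots n U.

Definition backward_euler (M : nat) (A B : 'M[R]_M) (F U0 : 'cV[R]_M)
    (tau : R) (N : nat) (U : nat -> 'cV[R]_M) :=
  U 0%N = U0 /\
  forall m, (m < N)%N ->
    (A + tau *: B) *m U m.+1 = A *m U m + tau *: F.

Definition reference (M : nat) (A B : 'M[R]_M) (U0 : 'cV[R]_M) (tau : R) :
    nat -> 'cV[R]_M :=
  fun m => (1 - tau * spectral_norm (scaled_stiffness A B)) ^+ m *: U0.

End Snapshots.

(* Main.v *)
Require Import Defs.
From mathcomp Require Import all_boot all_order all_algebra.
From mathcomp Require Import all_classical all_reals all_analysis.
From mathcomp Require Import ring lra.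
From mathcomp.real_closed Require complex.
Set Implicit Arguments.
Unset Strict Implicit.
Unset Printing Implicit Defensive.
Import Order.TTheory GRing.Theory Num.Theory.
Import numFieldNormedType.Exports.
Local Open Scope classical_set_scope.
Local Open Scope ring_scope.

(** For [m <= n] every snapshot [U_m], and every reference vector, lies within
    O(n tau) of [U_0]: the mass-matrix norm of [U_m - U_0] grows by at most
    O(tau) per step, as testing the scheme against [U_m - U_0] shows. So all
    entries of both Gram matrices lie within delta = O(n tau) of |U_0|^2. The
    Rayleigh quotient of the all-ones vector bounds the largest eigenvalue below
    by (n+1)(|U_0|^2 - delta), while the trace bounds the sum of the (nonnegative)
    eigenvalues above by (n+1)(|U_0|^2 + delta). Hence both the gap between the
    largest eigenvalues and the sum of the remaining ones are at most
    2(n+1)delta = O(n^2 tau) = O(tau^(2 eps)), and the sum of squares of the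
    latter is at most the square of their sum. *)

(** * Inner products and norms of positive definite matrices *)

Section BilinearForm.
Context {R : realType}.

Definition bform (M : nat) (A : 'M[R]_M) (u v : 'cV[R]_M) : R :=
  (u^T *m A *m v) ord0 ord0.

(** A genuine norm when [posdef A]: [1%:M] gives the Euclidean one, the mass matrix the L2 norm of
    the finite element function with coefficients [v]. *)
Definition seminorm (M : nat) (A : 'M[R]_M) (v : 'cV[R]_M) : R :=
  Num.sqrt (bform A v v).

Lemma bformDr M (A : 'M[R]_M) u v w : bform A u (v + w) = bform A u v + bform A u w.
Proof. by rewrite /bform mulmxDr mxE. Qed.

Lemma bformZr M (A : 'M[R]_M) u a v : bform A u (a *: v) = a * bform A u v.
Proof. by rewrite /bform -scalemxAr mxE. Qed.

Lemma bformDl M (A : 'M[R]_M) u v w : bform A (u + v) w = bform A u w + bform A v w.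
Proof. by rewrite /bform linearD !mulmxDl mxE. Qed.

Lemma bformZl M (A : 'M[R]_M) a u v : bform A (a *: u) v = a * bform A u v.
Proof. by rewrite /bform linearZ -!scalemxAl mxE. Qed.

Lemma bformC M (A : 'M[R]_M) u v : A^T = A -> bform A u v = bform A v u.
Proof.
move=> At; rewrite /bform -[in LHS](trmxK (u^T *m A *m v)) mxE.
by rewrite !trmx_mul trmxK At mulmxA.
Qed.

Lemma bform1E M (u v : 'cV[R]_M) : bform 1%:M u v = \sum_i u i ord0 * v i ord0.
Proof.
by rewrite /bform mulmx1 mxE; apply: eq_bigr => i _; rewrite mxE.
Qed.

Lemma bform_ge0 M (A : 'M[R]_M) v : posdef A -> 0 <= bform A v v.
Proof.
move=> [_ Ap]; have [->|/Ap/ltW//] := eqVneq v 0.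
by rewrite /bform mulmx0 mxE.
Qed.

Lemma posdef1 M : posdef (1%:M : 'M[R]_M).
Proof.
split=> [|v v0]; first exact: trmx1.
have -> : (v^T *m 1%:M *m v) ord0 ord0 = \sum_i v i ord0 ^+ 2.
  exact: bform1E.
rewrite lt_neqAle sumr_ge0 ?andbT => [|i _]; last exact: sqr_ge0.
rewrite eq_sym; apply: contra v0 => /eqP s0.
apply/eqP/matrixP => i j; rewrite ord1 mxE; apply/eqP; rewrite -sqrf_eq0.
by rewrite (psumr_eq0P _ s0)// => k _; exact: sqr_ge0.
Qed.

Lemma posdef_unit M (A : 'M[R]_M) : posdef A -> A \in unitmx.
Proof.
move=> [_ Ap]; rewrite unitmxE unitfE; apply/negP => /det0P[v v0 vA].
have := Ap v^T; rewrite trmxK vA mul0mx mxE ltxx => H; suff: false by [].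
by apply: H; apply: contra v0 => /eqP/(congr1 trmx); rewrite trmxK trmx0 => ->.
Qed.

Lemma cauchy_schwarz M (A : 'M[R]_M) u v : posdef A ->
  `|bform A u v| <= seminorm A u * seminorm A v.
Proof.
move=> Ap; have u0 := bform_ge0 u Ap; have v0 := bform_ge0 v Ap.
rewrite /seminorm -sqrtrM// -sqrtr_sqr ler_sqrt ?mulr_ge0//.
have [->|vn0] := eqVneq v 0.
  by rewrite -[0](scale0r 0) bformZr mul0r expr0n/= mulr_ge0// bformZr mul0r.
have vp : 0 < bform A v v by apply Ap.2.
(* This is the part of [u] that is A-orthogonal to [v], scaled by [bform A v v] to avoid division;
   its square is that factor times the Gram determinant of [u] and [v]. *)
have := bform_ge0 (bform A v v *: u - bform A u v *: v) Ap.
have -> : bform A (bform A v v *: u - bform A u v *: v)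
    (bform A v v *: u - bform A u v *: v)
    = bform A v v * (bform A u u * bform A v v - bform A u v ^+ 2).
  rewrite -scaleNr !(bformDr, bformDl, bformZr, bformZl) (bformC v u Ap.1).
  by ring.
by rewrite pmulr_rge0// subr_ge0.
Qed.

Lemma seminorm_ge0 M (A : 'M[R]_M) v : 0 <= seminorm A v.
Proof. exact: sqrtr_ge0. Qed.

Lemma sqr_seminorm M (A : 'M[R]_M) v : posdef A -> seminorm A v ^+ 2 = bform A v v.
Proof. by move=> /(bform_ge0 v)/sqr_sqrtr. Qed.

Lemma seminormZ M (A : 'M[R]_M) a v : seminorm A (a *: v) = `|a| * seminorm A v.
Proof.
by rewrite /seminorm bformZl bformZr mulrA -expr2 sqrtrM ?sqr_ge0// sqrtr_sqr.
Qed.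

(* Each coordinate of [v] is the A-inner product of [v] with a column of the
   inverse of [A]. *)
Lemma euclidean_le_seminorm M (A : 'M[R]_M) : posdef A ->
  exists2 c, 0 <= c & forall v, seminorm 1%:M v <= c * seminorm A v.
Proof.
move=> Ap; have Au := posdef_unit Ap.
exists (Num.sqrt (\sum_i seminorm A (invmx A *m delta_mx i ord0) ^+ 2)) => [|v].
  exact: sqrtr_ge0.
rewrite -[X in _ * X]ger0_norm ?seminorm_ge0// -sqrtr_sqr -sqrtrM; last first.
  by apply: sumr_ge0 => i _; exact: sqr_ge0.
rewrite /seminorm ler_sqrt; last first.
  by rewrite mulr_ge0 ?sqr_ge0// sumr_ge0// => i _; exact: sqr_ge0.
rewrite bform1E mulr_suml; apply: ler_sum => i _.
have -> : v i ord0 = bform A (invmx A *m delta_mx i ord0) v.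
  rewrite bformC ?Ap.1// /bform -mulmxA mulKVmx//.
  by rewrite -colE !mxE.
rewrite -expr2 -real_normK ?num_real// -exprMn ler_sqr ?nnegrE//.
  exact: cauchy_schwarz.
Qed.

End BilinearForm.

(** * Spectra of real symmetric matrices *)

Section Eigenvalues.
Import complex.
Local Open Scope sesquilinear_scope.
Context {R : realType}.

Lemma size_spectrum m (Y : 'M[R]_m) : Y^T = Y -> size (spectrum_seq Y) = m.
Proof.
move=> /symmetric_spectrum[_ pE]; apply: succn_inj.
by rewrite -(size_prod_XsubC _ id) -pE size_char_poly.
Qed.

(** Compares the coefficients of degree [m - 1] in the two forms of the characteristic polynomial;
    [m = 0] has no such coefficient and is treated apart. *)
Lemma sum_eigval m (Y : 'M[R]_m) : Y^T = Y ->
  \sum_(0 <= k < m) eigval Y k = \tr Y.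
Proof.
move=> Ys; have sz := size_spectrum Ys; have [_ pE] := symmetric_spectrum Ys.
rewrite -{1}sz -(big_nth 0 predT id).
case: m Y Ys sz pE => [|m] Y Ys sz pE.
  by rewrite (size0nil sz) big_nil /mxtrace big_ord0.
apply: oppr_inj; rewrite -char_poly_trace// pE.
have := @coefPn_prod_XsubC _ (spectrum_seq Y); rewrite sz => <- //.
Qed.

(** A root forces the decreasing list to be nonempty, so [eigval Y 0] is its head and not the
    default 0. *)
Lemma root_char_eigval0 m (Y : 'M[R]_m) a : Y^T = Y ->
  root (char_poly Y) a -> a <= eigval Y 0.
Proof.
move=> /symmetric_spectrum[]; rewrite /eigval; set s := spectrum_seq Y => ss ->.
rewrite root_prod_XsubC; case: s ss => [//|b s] /= bs.
rewrite inE => /orP[/eqP->//|].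
have := order_path_min (rev_trans le_trans) bs.
by move=> /allP; apply.
Qed.

Lemma eigval_ge0 m (Y : 'M[R]_m) k : Y^T = Y ->
  (forall v, 0 <= bform Y v v) -> 0 <= eigval Y k.
Proof.
move=> Ys Yp; have [_ pE] := symmetric_spectrum Ys.
rewrite /eigval; have [km|km] := ltnP k (size (spectrum_seq Y)); last first.
  by rewrite nth_default.
have : root (char_poly Y) (eigval Y k).
  by rewrite pE root_prod_XsubC mem_nth.
(* Eigenvectors are rows, hence the form is evaluated at [v^T], where it equals the eigenvalue times
   a positive square norm. *)
rewrite -eigenvalue_root_char => /eigenvalueP[v vY v0].
have := Yp v^T; rewrite /bform trmxK vY -scalemxAl mxE.
rewrite pmulr_lge0//; have := (posdef1 m).2 v^T; rewrite trmxK mulmx1; apply.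
by apply: contra v0 => /eqP/(congr1 trmx); rewrite trmxK trmx0 => ->.
Qed.

(** Over the complex numbers a unitary [P] diagonalises [Y]; in the coordinates [w = P v] both sides
    are sums weighted by [|w_i|^2] and compare termwise. *)
Lemma rayleigh m (Y : 'M[R]_m) v : Y^T = Y ->
  bform Y v v <= eigval Y 0 * bform 1%:M v v.
Proof.
move=> Ys.
pose toC : {rmorphism R -> R[i]%C} := real_complex R.
pose YC := map_mx toC Y; pose vC := map_mx toC v.
have YCh : YC \is hermsymmx.
  apply: realsym_hermsym.
    by apply/is_hermitianmxP; rewrite expr0 scale1r map_mx_id// /YC map_trmx Ys.
  by apply/mxOverP => i j; rewrite mxE; apply/complex_realP; exists (Y i j).
have /orthomx_spectralP YE := hermitian_normalmx YCh.
have Dr := hermitian_spectral_diag_real YCh.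
set P := spectralmx YC in YE; set D := spectral_diag YC in YE Dr.
have Pun : P \is unitarymx by exact: spectral_unitarymx.
have Pu : P \in unitmx by exact: spectral_unit.
have Dle i : D ord0 i <= toC (eigval Y 0).
  (* Row [i] of [P] is a left eigenvector for the [i]-th diagonal entry. That entry is real, so it
     is also a root of the real characteristic polynomial. *)
  have Droot : root (char_poly YC) (D ord0 i).
    rewrite -eigenvalue_root_char; apply/eigenvalueP; exists (row i P).
      rewrite YE rowE !mulmxA mulmxK// -[_ *m diag_mx D]rowE row_diag_mx.
      by rewrite -scalemxAl.
    apply/eqP => /(congr1 (mulmx^~ (invmx P))); rewrite rowE mulmxK// mul0mx.
    by move=> /matrixP/(_ ord0 i)/eqP; rewrite !mxE !eqxx oner_eq0.
  have /complex_realP[a aE] : D ord0 i \is Num.real by move/mxOverP: Dr; exact.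
  move: Droot; rewrite aE /YC -map_char_poly fmorph_root lecR.
  exact: root_char_eigval0.
have vCE : vC ^t* = vC^T.
  apply/matrixP => i j; rewrite !mxE conj_Creal//.
  by apply/complex_realP; exists (v j i).
pose w := P *m vC.
have wE : w ^t* = vC^T *m invmx P.
  by rewrite /w trmx_mul map_mxM/= invmx_unitary// vCE.
have bE (B : 'M[R]_m) : toC (bform B v v) = (vC^T *m map_mx toC B *m vC) ord0 ord0.
  by rewrite /bform /vC map_trmx -!map_mxM [RHS]mxE.
have sqE (z : 'rV[R[i]%C]_m) :
    (w ^t* *m diag_mx z *m w) ord0 ord0 = \sum_i z ord0 i * `|w i ord0| ^+ 2.
  rewrite mxE; apply: eq_bigr => i _.
  by rewrite mul_mx_diag !mxE normCK mulrAC mulrC [_^* * _]mulrC.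
rewrite -lecR -/(toC _) -[X in _ <= X]/(toC _) rmorphM/= !bE map_mx1.
rewrite -/YC YE.
have -> : vC^T *m (invmx P *m diag_mx D *m P) *m vC = w ^t* *m diag_mx D *m w.
  by rewrite wE /w !mulmxA.
(* The identity is seen as a constant diagonal, so that [sqE] applies to both sides. *)
have -> : vC^T *m 1%:M *m vC = w ^t* *m diag_mx (const_mx 1) *m w.
  by rewrite wE diag_const_mx !mulmx1 /w mulmxA mulmxKV.
rewrite !sqE mulr_sumr; apply: ler_sum => i _.
by rewrite [const_mx _ _ _]mxE mul1r ler_wpM2r// exprn_ge0.
Qed.
End Eigenvalues.

(** * Spectra of Gram matrices with nearly equal entries *)

Section GramSpectrum.
Context {R : realType}.

(** Needs no boundedness: without a supremum, [sup] takes its default value 0. *)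
Lemma spectral_norm_ge0 M (A : 'M[R]_M) : 0 <= spectral_norm A.
Proof.
rewrite /spectral_norm; set E := [set _ | _ in _].
have [sE|/sup_out->//] := pselect (has_sup E).
have [y Ey] := sE.1; apply: le_trans (sup_upper_bound sE Ey).
by case: Ey => v _ <-; exact: sqrtr_ge0.
Qed.

Lemma gramE M n (U : nat -> 'cV[R]_M) i j :
  gram n U i j = bform 1%:M (U i) (U j).
Proof.
by rewrite bform1E mxE; apply: eq_bigr => k _; rewrite !mxE.
Qed.

Lemma gram_sym M n (U : nat -> 'cV[R]_M) : (gram n U)^T = gram n U.
Proof. by rewrite /gram trmx_mul trmxK. Qed.

Lemma gram_psd M n (U : nat -> 'cV[R]_M) v : 0 <= bform (gram n U) v v.
Proof.
have := bform_ge0 (snapshots n U *m v) (posdef1 M).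
by rewrite /bform mulmx1 trmx_mul /gram !mulmxA.
Qed.

Lemma sum_sqr_le_sqr_sum (I : Type) (r : seq I) (F : I -> R) :
  (forall i, 0 <= F i) -> \sum_(i <- r) F i ^+ 2 <= (\sum_(i <- r) F i) ^+ 2.
Proof.
(* Nonnegativity of the partial sums is carried through the induction to control the cross terms. *)
move=> F0; suff [] : 0 <= \sum_(i <- r) F i /\
  \sum_(i <- r) F i ^+ 2 <= (\sum_(i <- r) F i) ^+ 2 by [].
elim/big_ind2: _ => [|a b c e [b0 ab] [e0 ce]|i _]; rewrite ?expr0n//.
split; first exact: addr_ge0.
by rewrite sqrrD addrAC ler_wpDr ?mulrn_wge0 ?mulr_ge0// lerD.
Qed.

Section NearConstant.
Variables (M n : nat) (U : nat -> 'cV[R]_M) (a delta : R).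
Hypothesis Ua : forall i j, (i <= n)%N -> (j <= n)%N ->
  `|bform 1%:M (U i) (U j) - a| <= delta.

Lemma gram_eigval0_ge : n.+1%:R * (a - delta) <= eigval (gram n U) 0.
Proof.
have := rayleigh (const_mx 1 : 'cV[R]_n.+1) (gram_sym n U).
rewrite bform1E; under eq_bigr do rewrite !mxE mulr1.
rewrite sumr_const card_ord -[1 *+ _]/(n.+1%:R) => H.
(* After multiplication by [n + 1], the square norm of the all-ones vector, the claim compares the
   sum of all [(n + 1)^2] entries with as many copies of [a - delta]. *)
rewrite -(ler_pM2r (ltr0Sn R n)); apply: le_trans H.
rewrite /bform mxE.
have -> : n.+1%:R * (a - delta) * n.+1%:R =
    \sum_(j < n.+1) (\sum_(i < n.+1) (a - delta)).
  by rewrite !sumr_const card_ord -mulrnA -[RHS]mulr_natr natrM; ring.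
apply: ler_sum => j _; rewrite !mxE mulr1; apply: ler_sum => i _.
rewrite mxE mxE mul1r gramE.
have := @Ua i j (ltn_ord i) (ltn_ord j).
by rewrite ler_norml => /andP[]; lra.
Qed.

Lemma gram_trace_le : \tr (gram n U) <= n.+1%:R * (a + delta).
Proof.
rewrite /mxtrace mulr_natl -[X in _ *+ X](card_ord n.+1) -sumr_const.
apply: ler_sum => i _; rewrite gramE.
have := @Ua i i (ltn_ord i) (ltn_ord i).
by rewrite ler_norml => /andP[_]; lra.
Qed.

Lemma gram_eigval_tail : \sum_(1 <= k < n.+1) eigval (gram n U) k =
  \tr (gram n U) - eigval (gram n U) 0.
Proof. by rewrite -(sum_eigval (gram_sym n U)) [in RHS]big_ltn// [RHS]addrC addKr. Qed.

Lemma gram_eigval0_le : eigval (gram n U) 0 <= n.+1%:R * (a + delta).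
Proof.
apply: le_trans gram_trace_le; rewrite -subr_ge0 -gram_eigval_tail.
apply: sumr_ge0 => k _. exact: (eigval_ge0 k (gram_sym n U) (gram_psd U)).
Qed.

Lemma gram_eigval_tail_sqr : \sum_(1 <= k < n.+1) eigval (gram n U) k ^+ 2 <=
  (n.+1%:R * (2 * delta)) ^+ 2.
Proof.
have X0 k := eigval_ge0 k (gram_sym n U) (gram_psd U).
apply: le_trans (sum_sqr_le_sqr_sum _ X0) _.
rewrite ler_sqr ?nnegrE ?sumr_ge0//.
  by rewrite gram_eigval_tail; have := gram_trace_le; have := gram_eigval0_ge; lra.
(* [delta] is nonnegative because it bounds an absolute value, here at the indices 0, 0. *)
rewrite mulr_ge0// mulr_ge0//; exact: le_trans (Ua (leq0n n) (leq0n n)).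
Qed.

End NearConstant.

(** * Distance of snapshots and reference vectors from the initial vector *)

Lemma near_constant_bform M (u0 u v : 'cV[R]_M) rho :
  seminorm 1%:M (u - u0) <= rho -> seminorm 1%:M (v - u0) <= rho ->
  `|bform 1%:M u v - bform 1%:M u0 u0|
    <= (2 * seminorm 1%:M u0 + rho) * rho.
Proof.
move=> urho vrho; set p := u - u0 in urho *; set q := v - u0 in vrho *.
have -> : u = u0 + p by rewrite addrC subrK.
have -> : v = u0 + q by rewrite addrC subrK.
clearbody p q; rewrite !(bformDr, bformDl).
set a := bform _ u0 u0; set b := bform _ p u0; set c := bform _ u0 q.
set e := bform _ p q; set s := seminorm _ u0.
have bs : `|b| <= s * rho.
  apply: le_trans (cauchy_schwarz _ _ (posdef1 M)) _.
  by rewrite mulrC ler_wpM2l ?seminorm_ge0.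
have cs : `|c| <= s * rho.
  apply: le_trans (cauchy_schwarz _ _ (posdef1 M)) _.
  by rewrite ler_wpM2l ?seminorm_ge0.
have es : `|e| <= rho * rho.
  apply: le_trans (cauchy_schwarz _ _ (posdef1 M)) _.
  by rewrite ler_pM ?seminorm_ge0.
by move: bs cs es; rewrite !ler_norml => /andP[? ?] /andP[? ?] /andP[? ?]; lra.
Qed.

(** With [w], [z] the new and old increments and [g = A^-1 (F - B U0)], the scheme reads
    [(A + tau B) w = A z + tau A g]. Testing with [w] and dropping the nonnegative [B] term gives
    [|w|_A <= |z|_A + tau |g|_A], with no growth factor. *)
Lemma backward_euler_increment M (A B : 'M[R]_M) (F U0 : 'cV[R]_M) :
  posdef A -> posdef B ->
  exists2 L, 0 <= L & forall tau N U, 0 < tau -> backward_euler A B F U0 tau N U ->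
    forall m, (m <= N)%N -> seminorm 1%:M (U m - U0) <= L * (m%:R * tau).
Proof.
move=> Ap Bp; have [c c0 cP] := euclidean_le_seminorm Ap.
pose g := invmx A *m (F - B *m U0).
exists (c * seminorm A g) => [|tau N U tau0 [UU0 Ustep] m mN].
  by rewrite mulr_ge0 ?seminorm_ge0.
(* The induction runs in the A-norm, so the equivalence constant [c] is paid once and does not
   compound. *)
apply: le_trans (cP _) _; rewrite -mulrA ler_wpM2l//.
elim: m mN => [_|m IH mN].
  by rewrite UU0 subrr -(scale0r 0) seminormZ normr0 !mul0r mulr0.
set w := U m.+1 - U0; have := IH (ltnW mN); set z := U m - U0 => zle.
have step : A *m w + tau *: (B *m w) = A *m z + tau *: (A *m g).
  rewrite /g mulKVmx ?posdef_unit// /w /z !mulmxBr !scalerBr.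
  have := Ustep _ mN; rewrite mulmxDl -scalemxAl => E.
  rewrite addrACA E -opprD; move: (A *m U0) (tau *: (B *m U0)) => x y.
  by rewrite opprD addrACA.
clearbody g w z.
have wstep : bform A w w + tau * bform B w w = bform A w z + tau * bform A w g.
  have entry (X Y : 'M[R]_1) : (X + tau *: Y) ord0 ord0 = X ord0 ord0 + tau * Y ord0 ord0.
    by rewrite !mxE.
  have := congr1 (fun x => (w^T *m x) ord0 ord0) step.
  by rewrite /= !mulmxDr -!scalemxAr !mulmxA !entry.
have Bw := mulr_ge0 (ltW tau0) (bform_ge0 w Bp).
have wz := le_trans (ler_norm _) (cauchy_schwarz w z Ap).
have wg := le_trans (ler_norm _) (cauchy_schwarz w g Ap).
have := sqr_seminorm w Ap; have := seminorm_ge0 A w.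
have tg : tau * bform A w g <= tau * (seminorm A w * seminorm A g).
  by rewrite ler_wpM2l// ltW.
(* The case [|w|_A = 0] is split off because the other one cancels this factor. *)
rewrite le0r => /orP[/eqP-> _|w0 wE].
  by rewrite mulr_ge0 ?seminorm_ge0// mulr_ge0// ltW.
rewrite -(ler_pM2l w0) -expr2 wE.
have := ler_wpM2l (ltW w0) zle; rewrite -natr1; lra.
Qed.

(** Bernoulli's inequality [1 - (1 - t)^m <= m t] on [0 <= t <= 1], with [t = tau * nu]. *)
Lemma reference_increment M (A B : 'M[R]_M) (U0 : 'cV[R]_M) tau m :
  0 <= tau -> tau * spectral_norm (scaled_stiffness A B) <= 1 ->
  seminorm 1%:M (reference A B U0 tau m - U0) <=
    spectral_norm (scaled_stiffness A B) * seminorm 1%:M U0 * (m%:R * tau).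
Proof.
move=> tau0; rewrite /reference; set nu := spectral_norm _ => tnu.
have tnu0 : 0 <= tau * nu by rewrite mulr_ge0 ?spectral_norm_ge0.
rewrite -{2}[U0]scale1r -scalerBl seminormZ.
rewrite [X in _ <= X](_ : _ = m%:R * (tau * nu) * seminorm 1%:M U0); last by ring.
rewrite ler_wpM2r ?seminorm_ge0//; move: (tau * nu) tnu tnu0 => t t1 t0.
rewrite distrC ger0_norm; last first.
  by rewrite subr_ge0 exprn_ile1//; lra.
elim: m => [|m IH]; first by rewrite expr0 subrr mul0r.
have q1 : 0 <= (1 - t) ^+ m by rewrite exprn_ge0//; lra.
have q2 : (1 - t) ^+ m <= 1 by rewrite exprn_ile1//; lra.
have := ler_wpM2l t0 q2; rewrite exprS -natr1; lra.
Qed.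

(** * Powers of the time step and choice of the constant *)

Lemma powR_step_bound (n : nat) (K eps tau : R) : 0 < tau ->
  n%:R <= K * tau `^ (- 2^-1 + eps) ->
  (n%:R * n%:R * tau) ^+ 2 <= K ^+ 4 * tau `^ (4 * eps).
Proof.
move=> tau0 nK.
have -> : K ^+ 4 * tau `^ (4 * eps) = (K * tau `^ (- 2^-1 + eps)) ^+ 4 * tau ^+ 2.
  (* The fourth power of the bound on [n] has exponent [4 eps - 2]; the factor [tau ^+ 2] restores
     [4 eps]. *)
  have -> : 4 * eps = (- 2^-1 + eps) * 4%:R + 2%:R by lra.
  rewrite powRD; last by apply/implyP => _; rewrite gt_eqF.
  by rewrite powRrM !powR_mulrn ?powR_ge0 ?ltW// exprMn mulrA.
have -> : (n%:R * n%:R * tau) ^+ 2 = n%:R ^+ 4 * tau ^+ 2 by ring.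
by rewrite ler_wpM2r ?sqr_ge0// lerXn2r ?nnegrE// (le_trans _ nK).
Qed.

End GramSpectrum.

Lemma backward_euler_spectrum (R : realType) M (A B : 'M[R]_M) (F U0 : 'cV[R]_M)
    (T eps K : R) : posdef A -> posdef B -> 0 < T ->
  exists2 C : R, 0 < C & forall (N n : nat) (tau := T / N%:R) (U : nat -> 'cV[R]_M),
    (0 < N)%N -> tau * spectral_norm (scaled_stiffness A B) <= 1 ->
    (n <= N)%N -> n%:R <= K * tau `^ (- 2^-1 + eps) ->
    backward_euler A B F U0 tau N U ->
    (eigval (gram n U) 0 - eigval (gram n (reference A B U0 tau)) 0) ^+ 2
      + \sum_(1 <= k < n.+1) eigval (gram n U) k ^+ 2 <= C * tau `^ (4 * eps).
Proof.
move=> Ap Bp T0; have [L1 L10 L1P] := backward_euler_increment F U0 Ap Bp.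
set nu := spectral_norm _; pose e := seminorm 1%:M U0.
have nu0 : 0 <= nu := spectral_norm_ge0 _; have e0 : 0 <= e := seminorm_ge0 _ _.
pose L := L1 + nu * e; have L0 : 0 <= L by rewrite addr_ge0 ?mulr_ge0.
(* [L] serves both sequences. For [rho = L n tau], the bound [(2 e + rho) rho] is at most [H n tau],
   since [n tau <= T]. *)
pose H := (2 * e + L * T) * L.
have H0 : 0 <= H by rewrite mulr_ge0// addr_ge0 ?mulr_ge0// ltW.
(* Head and tail each contribute [4 H^2 * 4 K^4]; the added 1 makes the constant positive even if
   [H] or [K] vanishes. *)
exists (32 * H ^+ 2 * K ^+ 4 + 1).
  by rewrite ltr_wpDl// mulr_ge0 ?exprn_even_ge0// mulr_ge0 ?exprn_even_ge0//.
move=> N n tau U N0 taunu nN nK UE.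
have NR : 0 < N%:R :> R by rewrite ltr0n.
have tau0 : 0 < tau by rewrite divr_gt0.
have nT : n%:R * tau <= T.
  by rewrite mulrC -mulrA ger_pMr// mulrC ler_pdivrMr// mul1r ler_nat.
pose delta := H * (n%:R * tau).
have delta0 : 0 <= delta by rewrite mulr_ge0// mulr_ge0// ltW.
have near (V : nat -> 'cV[R]_M) l : l <= L ->
    (forall m, (m <= n)%N -> seminorm 1%:M (V m - U0) <= l * (m%:R * tau)) ->
    forall i j, (i <= n)%N -> (j <= n)%N ->
    `|bform 1%:M (V i) (V j) - bform 1%:M U0 U0| <= delta.
  move=> lL VP i j ni nj.
  have V' m : (m <= n)%N -> seminorm 1%:M (V m - U0) <= L * (n%:R * tau).
    move=> mn; apply: le_trans (VP _ mn) _.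
    have m0 : 0 <= m%:R * tau by rewrite mulr_ge0// ltW.
    apply: le_trans (ler_wpM2r m0 lL) _.
    by rewrite ler_wpM2l// ler_wpM2r ?ler_nat// ltW.
  apply: le_trans (near_constant_bform (V' _ ni) (V' _ nj)) _.
  rewrite /delta /H -/e -[in leRHS]mulrA ler_wpM2r//.
    by rewrite !mulr_ge0// ltW.
  by rewrite lerD2l ler_wpM2l.
have UP := near U L1 _ (fun m mn => L1P _ _ _ tau0 UE m (leq_trans mn nN)).
have /UP{}UP : L1 <= L by rewrite ler_wpDr// mulr_ge0.
have RP := near _ (nu * e) _ (fun m _ => reference_increment U0 m (ltW tau0) taunu).
have /RP{}RP : nu * e <= L by rewrite ler_wpDl.
set X := gram n U; set Y := gram n (reference _ _ _ _).
have X1 := gram_eigval0_ge UP; have X2 := gram_eigval0_le UP.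
have Y1 := gram_eigval0_ge RP; have Y2 := gram_eigval0_le RP.
have tail := gram_eigval_tail_sqr UP.
have head : (eigval X 0 - eigval Y 0) ^+ 2 <= (n.+1%:R * (2 * delta)) ^+ 2.
  rewrite -real_normK ?num_real// lerXn2r ?nnegrE//.
    by rewrite mulr_ge0// mulr_ge0.
  by rewrite ler_norml; apply/andP; split; rewrite /X /Y; lra.
apply: le_trans (lerD head tail) _.
(* The factor [n] coming from [delta] lets [n + 1] be replaced by [2 n] even at [n = 0], where both
   sides vanish. *)
have nn : n.+1%:R * (n%:R * tau) <= 2 * (n%:R * n%:R * tau).
  have : n.+1%:R * n%:R <= 2 * (n%:R * n%:R) :> R.
    rewrite -!natrM ler_nat mulnA leq_mul2r; case: (n) => //= k.
    by rewrite mul2n -addnn addSn addnS !ltnS leq_addr.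
  by move=> /(ler_wpM2r (ltW tau0)); rewrite -!mulrA.
have nn2 : (n.+1%:R * (n%:R * tau)) ^+ 2 <= 4 * (K ^+ 4 * tau `^ (4 * eps)).
  apply: (@le_trans _ _ ((2 * (n%:R * n%:R * tau)) ^+ 2)).
    by rewrite lerXn2r ?nnegrE// !mulr_ge0// ltW.
  have := powR_step_bound tau0 nK; rewrite exprMn; lra.
have -> : (n.+1%:R * (2 * delta)) ^+ 2 = 4 * H ^+ 2 * (n.+1%:R * (n%:R * tau)) ^+ 2.
  by rewrite /delta; ring.
have := ler_wpM2l (sqr_ge0 H) nn2; have := powR_ge0 tau (4 * eps); lra.
Qed.

Theorem corollary4p1 (R : realType) (d : nat) (hd : (1 <= d <= 3)%N)
    (D : set 'rV[R]_d) (hD : bounded_domain D)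
    (T : R) (hT : 0 < T)
    (alpha : 'rV[R]_d -> 'M[R]_d)
    (alpha_sym : forall y, D y -> (alpha y)^T = alpha y)
    (alpha_W : forall k j, in_W1infty D (fun y => alpha y k j))
    (c : 'rV[R]_d -> R) (hc : in_Linfty D c)
    (f : 'rV[R]_d -> R) (hf : in_L2 D f)
    (u0 : 'rV[R]_d -> R)
    (J : nat) (mesh : 'I_J -> 'I_d.+1 -> 'rV[R]_d)
    (hmesh : simplicial_mesh D mesh)
    (r : nat) (hr : (1 <= r)%N)
    (M : nat) (x : 'I_M -> 'rV[R]_d) (hx : interior_nodes D mesh r x)
    (phi : 'I_M -> 'rV[R]_d -> R) (hphi : nodal_basis D mesh r x phi)
    (hMass : posdef (mass_matrix D phi))
    (hStiff : posdef (stiffness_matrix D alpha c phi))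
    (eps : R) (heps : 0 < eps < 2^-1) (K : R) (hK : 0 < K) :
  let Mass := mass_matrix D phi in
  let Stiff := stiffness_matrix D alpha c phi in
  let F := load_vector D f phi in
  let U0 := nodal_values x (interpolant x phi u0) in
  let A := scaled_stiffness Mass Stiff in
  exists2 C : R, 0 < C &
    forall N : nat, (0 < N)%N ->
    let tau := T / N%:R in
    tau < 1 ->
    Num.max (tau * spectral_norm A) (spectral_norm (1%:M - tau *: A)) < 1 ->
    forall n : nat, (n <= N)%N ->
    n%:R <= K * tau `^ (- 2^-1 + eps) ->
    forall U : nat -> 'cV[R]_M, backward_euler Mass Stiff F U0 tau N U ->
    let X := gram n U in
    let Xref := gram n (reference Mass Stiff U0 tau) in
    (eigval X 0 - eigval Xref 0) ^+ 2 + \sum_(1 <= k < n.+1) eigval X k ^+ 2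
      <= C * tau `^ (4 * eps).
Proof.
move=> Mass Stiff F U0 A.
have [C C0 CP] := backward_euler_spectrum F U0 eps K hMass hStiff hT.
exists C => // N N0 tau _; rewrite gt_max => /andP[tauA _] n nN nK U UE.
exact: CP N0 (ltW tauA) nN nK UE.
Qed.
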